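(* A proper element $q\in L$ is $\phi$-$\delta$-primary if and only if for every $a\in L$ such that $a\not\leqslant q$, either $(q:a)\leqslant \delta(q)$ or $(q:a)=(\phi(q):a)$.
   Context: A multiplicative lattice is a complete lattice (least element $0$, greatest element $1$) with a commutative, associative multiplication that distributes over arbitrary joins and for which $1$ is the identity. An element $a$ is compact if $a\leqslant \bigvee X$ with $X\subseteq L$ implies $a\leqslant a_1\vee\dots\vee a_n$ for finitely many $a_i\in X$; $L$ is compactly generated if every element is a join of compact elements. Standing assumptions: $L$ is a compactly generated multiplicative lattice in which $1$ is compact and every finite product of compact elements is compact; $\delta:L\to L$ is an expansion function, i.e. $a\leqslant\delta(a)$ for all $a$, and $a\leqslant b$ implies $\delta(a)\leqslant\delta(b)$; $\phi:L\to L$ is a function with $\phi(a)\leqslant a$ for all $a$. An element $p$ is proper if $p<1$. For $a,b\in L$, $(a:b)=\bigvee\{x\in L\mid xb\leqslant a\}$. A proper element $p\in L$ is $\phi$-$\delta$-primary if for all $a,b\in L$, $ab\leqslant p$ and $ab\not\leqslant\phi(p)$ implies either $a\leqslant p$ or $b\leqslant\delta(p)$. *)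

(* Defs.v *)
From HB Require Import structures.
From mathcomp Require Import all_boot all_order.
From mathcomp Require Import boolp classical_sets.

Set Implicit Arguments.
Unset Strict Implicit.
Unset Printing Implicit Defensive.

Import Order.TTheory.
Local Open Scope classical_set_scope.
Local Open Scope order_scope.

HB.mixin Record TBLattice_isComplete d L of Order.TBLattice d L := {
  supremums_neq0 : forall X : set L, supremums X !=set0
}.

#[short(type="completeLatticeType")]
HB.structure Definition CompleteLattice d :=
  { L of Order.TBLattice d L & TBLattice_isComplete d L }.

(* [supremum x0] returns x0 on the empty set, hence the default \bot. *)
Definition bigjoin d (L : completeLatticeType d) (X : set L) : L :=
  supremum \bot X.

Lemma bigjoinP d (L : completeLatticeType d) (X : set L) : isLub X (bigjoin X).
Proof.
rewrite /bigjoin /supremum; case: ifPn => [/eqP ->|_].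
  by split=> [x []|b _]; rewrite le0x.
by case: xgetP => [x _ []//|none]; have [x /none] := supremums_neq0 X.
Qed.

HB.mixin Record CompleteLattice_isMultiplicative d L of CompleteLattice d L := {
  lmul : L -> L -> L;
  lmulA : associative lmul;
  lmulC : commutative lmul;
  lmul1x : left_id \top lmul;
  lmul_bigjoinr : forall (a : L) (X : set L),
    lmul a (bigjoin X) = bigjoin [set lmul a x | x in X]
}.

#[short(type="multLatticeType")]
HB.structure Definition MultLattice d :=
  { L of CompleteLattice d L & CompleteLattice_isMultiplicative d L }.

Declare Scope mult_lattice_scope.
Delimit Scope mult_lattice_scope with ML.
Infix "*" := lmul : mult_lattice_scope.
Local Open Scope mult_lattice_scope.

Section MultLatticeNotions.
Context {d : Order.disp_t} {L : multLatticeType d}.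

Definition compact_elt (a : L) : Prop :=
  forall X : set L, a <= bigjoin X ->
  exists2 s : seq L, (forall x, x \in s -> X x) & a <= \join_(x <- s) x.

Definition expansion (delta : L -> L) : Prop :=
  (forall a, a <= delta a) /\ {homo delta : a b / a <= b}.

Definition proper_elt (p : L) : Prop := p < \top.

Definition residual (a b : L) : L := bigjoin [set x | x * b <= a].

Definition phi_delta_primary (phi delta : L -> L) (p : L) : Prop :=
  proper_elt p /\
  forall a b : L, a * b <= p -> ~ (a * b <= phi p) -> a <= p \/ b <= delta p.

End MultLatticeNotions.

Definition compactly_generated d (L : multLatticeType d) : Prop :=
  forall a : L, exists2 X : set L, X `<=` compact_elt & a = bigjoin X.

Definition compact_prod_closed d (L : multLatticeType d) : Prop :=
  forall s : seq L, (forall x, x \in s -> compact_elt x) ->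
  compact_elt (\big[lmul / \top]_(x <- s) x).

(* Main.v *)
Require Import Defs.
From mathcomp Require Import all_boot all_order.
From mathcomp Require Import boolp classical_sets.

(** Since multiplication distributes over arbitrary joins, [fun x => x * b] has
    [fun a => residual a b] as right adjoint ([le_residual]).  In particular
    [r := residual q a] is the largest element with [r * a <= q], so the single
    product [r * a] decides the dichotomy.  If it lies below [phi q], then
    [r <= residual (phi q) a], and the two residuals agree because
    [phi q <= q].  Otherwise the primary condition applies to the pair [(a, r)]
    and gives [r <= delta q].  Conversely, [a * b <= q] says that
    [b <= residual q a], and either alternative for the residual then
    concerns [b] itself. *)

Local Open Scope order_scope.
Local Open Scope mult_lattice_scope.
Local Open Scope classical_set_scope.

Section Residuation.
Context {d : Order.disp_t} {L : multLatticeType d}.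
Implicit Types (a b x y : L).

Lemma bigjoin_ge (X : set L) x : X x -> x <= bigjoin X.
Proof. by move=> Xx; case: (bigjoinP X) => ub _; exact: ub. Qed.

Lemma bigjoin_le (X : set L) a : (forall x, X x -> x <= a) -> bigjoin X <= a.
Proof. by move=> Xa; case: (bigjoinP X) => _; apply. Qed.

(** Distributivity gives monotonicity because [y] is the join of its down-set,
    to which [x] belongs. *)
Lemma le_lmul2l a x y : x <= y -> a * x <= a * y.
Proof.
move=> lexy.
have -> : y = bigjoin [set z | z <= y].
  apply: Order.POrderTheory.le_anti; apply/andP; split.
    by apply: bigjoin_ge => /=; exact: Order.POrderTheory.lexx.
  exact: bigjoin_le.
by rewrite lmul_bigjoinr; apply: bigjoin_ge; exists x.
Qed.

(** Multiplying the join that defines the residual by [b] gives a join of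
    products [z * b <= a]; hence the residual attains its own defining bound. *)
Lemma le_residual x a b : x <= residual a b <-> x * b <= a.
Proof.
split=> [lex|]; last exact: bigjoin_ge.
rewrite lmulC; apply: Order.POrderTheory.le_trans (le_lmul2l _ _ _ lex) _.
rewrite lmul_bigjoinr; apply: bigjoin_le => _ [z zb <-].
by rewrite lmulC.
Qed.

Lemma residual_mono a a' b : a <= a' -> residual a b <= residual a' b.
Proof.
move=> leaa'; apply/le_residual; apply: Order.POrderTheory.le_trans leaa'.
by apply/le_residual; exact: Order.POrderTheory.lexx.
Qed.

End Residuation.

Local Close Scope classical_set_scope.
Local Close Scope mult_lattice_scope.

Theorem theorem2p10 (d : Order.disp_t) (L : multLatticeType d)
    (L_gen : compactly_generated L)
    (top_compact : compact_elt (\top : L))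
    (L_prod : compact_prod_closed L)
    (delta : L -> L) (delta_exp : expansion delta)
    (phi : L -> L) (phi_le : forall a : L, phi a <= a)
    (q : L) (q_proper : proper_elt q) :
  phi_delta_primary phi delta q <->
  (forall a : L, ~ (a <= q) ->
     residual q a <= delta q \/ residual q a = residual (phi q) a).
Proof.
split=> [[_ q_primary] a Naq | residual_cases].
  have raq : lmul (residual q a) a <= q.
    by apply/le_residual; exact: Order.POrderTheory.lexx.
  have [ra_phi | Nra_phi] := pselect (lmul (residual q a) a <= phi q).
    right; apply: Order.POrderTheory.le_anti; apply/andP; split.
      exact/le_residual.
    exact/residual_mono/phi_le.
  left; rewrite lmulC in raq Nra_phi.
  by have [/Naq|] := q_primary _ _ raq Nra_phi.
split=> // a b abq Nab_phi.
have [aq | Naq] := pselect (a <= q); [by left | right].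
have b_res : b <= residual q a by apply/le_residual; rewrite lmulC.
have [res_delta | res_eq] := residual_cases a Naq.
  exact: Order.POrderTheory.le_trans b_res res_delta.
by case: Nab_phi; rewrite lmulC; apply/le_residual; rewrite -res_eq.
Qed.
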